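(* Let $a_1,a_2\in\mathbb C$ with $a_1\neq 0$, and put $\alpha=1-a_1-2a_2$, $\beta=-2a_1^2$. Consider the Takasaki system $$\frac{dq}{dt}=p,\qquad \frac{dp}{dt}=\frac{8\beta}{q^3}+(t^2-\alpha)q+\frac{t}{2}q^3+\frac{3}{64}q^5 .$$ Let $E^{\mathrm{Tak}}\to\mathbb C_t$ be the bundle whose total space is obtained by gluing $\{(q,p,t)\in\mathbb C^3: q\neq 0\}$ with four further charts having coordinates $(u_i,v_i,t)$, $i=3,5,14,20$, via $$q=v_3(4a_1+u_3v_3^2),\quad \tfrac1p=v_3;\qquad q=v_5(-4a_1+u_5v_5^2),\quad \tfrac1p=v_5;$$ $$\tfrac1q=v_{14},\quad p=\frac{1}{v_{14}^{3}}\Big(\tfrac18+v_{14}^2\big(t+v_{14}^2(4(a_1+2a_2-2)+u_{14}v_{14}^2)\big)\Big);$$ $$\tfrac1q=v_{20},\quad p=\frac{1}{v_{20}^{3}}\Big(-\tfrac18+v_{20}^2\big(-t+v_{20}^2(-4(a_1+2a_2)+u_{20}v_{20}^2)\big)\Big),$$ where the charts $i=14,20$ are all of $\mathbb C^3$, the chart $i=3$ is $\{4a_1+u_3v_3^2\neq0\}\subset\mathbb C^3$, and the chart $i=5$ is $\{-4a_1+u_5v_5^2\neq 0\}\subset\mathbb C^3$. Then the Takasaki system, extended to $E^{\mathrm{Tak}}$ by these changes of variables, is everywhere on $E^{\mathrm{Tak}}$ either regular or quadratic regularisable.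
   Context: Quadratic regularisability: a first-order system for $(u(t),v(t))$ is quadratic regularisable in the variable $v$ if it has the form $$\frac{du}{dt}=R_1(t,u,v^2),\qquad \frac{dv}{dt}=\frac1v R_2(t,u,v^2),$$ where $R_1(t,x,y),R_2(t,x,y)$ are rational functions, both regular in $y$ at $y=0$, and $R_2(t,x,y)$ is nonzero at $y=0$. (With $h=v^2$ the system becomes $u'=R_1(t,u,h)$, $h'=2R_2(t,u,h)$, which is regular at $h=0$.) The system is everywhere either regular or quadratic regularisable if every point of the manifold lies in one of the listed charts in which either the right-hand sides of the system are holomorphic at that point, or the chart has coordinates $(u_i,v_i,t)$, the system in this chart is quadratic regularisable in $v_i$, and the point lies on $v_i=0$ with $R_1,R_2$ holomorphic at the corresponding point. *)

(* Defs.v *)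
From HB Require Import structures.
From mathcomp Require Import all_boot all_order all_algebra generic_quotient.
From mathcomp Require Import all_classical all_reals all_analysis.
From mathcomp Require Export complex.

Set Implicit Arguments.
Unset Strict Implicit.
Unset Printing Implicit Defensive.

Import Order.TTheory GRing.Theory Num.Theory.
Import numFieldNormedType.Exports.

Local Open Scope classical_set_scope.
Local Open Scope quotient_scope.
Local Open Scope ring_scope.

(* The definitions make sense over any numFieldType K.  They are meant for    *)
(* K := R[i] with R : realType, i.e. for the complex numbers, where           *)
(* "differentiable on a neighbourhood" is "holomorphic".                      *)

(* dom is where the function is given, graph y w says that its value at y is  *)
(* w; x itself need not belong to dom.                                        *)
Definition holomorphic_at (K : numFieldType) (W : normedModType K)
    (dom : set (K * K * K)) (graph : K * K * K -> W -> Prop)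
    (x : K * K * K) : Prop :=
  exists F : K * K * K -> W,
    (\forall y \near x, differentiable F y) /\
    (\forall y \near x, dom y -> graph y (F y)).

Section RationalFunctions.
Variable K : numFieldType.

(* Rational functions of (t, x, y); the outermost polynomial variable is y    *)
(* and the innermost one is t.                                                *)
Definition ratfun := {fraction {poly {poly {poly K}}}}.

Definition eval3 (P : {poly {poly {poly K}}}) (t x y : K) : K :=
  P.[y%:P%:P].[x%:P].[t].

Definition ratfun_val (f : ratfun) (z : K * K * K) (c : K) : Prop :=
  let: (t, x, y) := z in
  exists N D : {poly {poly {poly K}}},
    [/\ f = tofrac N / tofrac D, eval3 D t x y != 0
      & c = eval3 N t x y / eval3 D t x y].

Definition ratfun_def (f : ratfun) : set (K * K * K) :=
  [set z | exists c, ratfun_val f z c].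

Definition ratfun_holomorphic_at (f : ratfun) (z : K * K * K) : Prop :=
  holomorphic_at (W := K) (ratfun_def f) (ratfun_val f) z.

(* f is regular in y at y = 0: the factor y does not occur in its denominator *)
Definition ratfun_regular0 (f : ratfun) : Prop :=
  exists N D : {poly {poly {poly K}}},
    f = tofrac N / tofrac D /\ D.[0] != 0.

Definition ratfun_nonzero0 (f : ratfun) : Prop :=
  forall t x c, ratfun_val f (t, x, 0) c -> c != 0.

(* A first-order system for (u, v) is given by its right-hand side on dom:    *)
(* rhs (u, v, t) (c, d) says that du/dt = c and dv/dt = d at (u, v, t).       *)
Definition quadratic_regularisable (dom : set (K * K * K))
    (rhs : K * K * K -> K * K -> Prop) (R1 R2 : ratfun) : Prop :=
  [/\ ratfun_regular0 R1, ratfun_regular0 R2, ratfun_nonzero0 R2 &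
    forall u v t c1 c2, dom (u, v, t) ->
      ratfun_val R1 (t, u, v ^+ 2) c1 -> ratfun_val R2 (t, u, v ^+ 2) c2 ->
      rhs (u, v, t) (c1, c2 / v)].

End RationalFunctions.

(* The vector field (dq/dt, dp/dt, dt/dt). *)
Definition takasaki (K : numFieldType) (alpha beta : K) (x : K * K * K) :
    K * K * K :=
  let: (q, p, t) := x in
  (p,
   8 * beta / q ^+ 3 + (t ^+ 2 - alpha) * q + t / 2 * q ^+ 3
     + 3 / 64 * q ^+ 5,
   1).

Inductive chart := chart_qp | chart3 | chart5 | chart14 | chart20.

HB.instance Definition _ := gen_eqMixin chart.
HB.instance Definition _ := gen_choiceMixin chart.

Section Takasaki.
Variables (K : numFieldType) (a1 a2 : K).

Definition chart_dom (i : chart) (x : K * K * K) : bool :=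
  let: (u, v, t) := x in
  match i with
  | chart_qp => u != 0
  | chart3 => 4 * a1 + u * v ^+ 2 != 0
  | chart5 => - 4 * a1 + u * v ^+ 2 != 0
  | chart14 | chart20 => true
  end.

(* The points of chart i that are glued to points of the (q, p, t)-chart. *)
Definition chart_overlap (i : chart) (x : K * K * K) : bool :=
  chart_dom i x &&
  match i with
  | chart_qp => true
  | _ => x.1.2 != 0
  end.

(* (q, p, t) as a function of the coordinates of chart i; meaningful on       *)
(* chart_overlap i.                                                           *)
Definition to_qpt (i : chart) (x : K * K * K) : K * K * K :=
  let: (u, v, t) := x in
  match i with
  | chart_qp => (u, v, t)
  | chart3 => (v * (4 * a1 + u * v ^+ 2), v^-1, t)
  | chart5 => (v * (- 4 * a1 + u * v ^+ 2), v^-1, t)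
  | chart14 =>
      (v^-1,
       1 / v ^+ 3 * (1 / 8 + v ^+ 2 * (t + v ^+ 2 *
         (4 * (a1 + 2 * a2 - 2) + u * v ^+ 2))),
       t)
  | chart20 =>
      (v^-1,
       1 / v ^+ 3 * (- (1 / 8) + v ^+ 2 * (- t + v ^+ 2 *
         (- 4 * (a1 + 2 * a2) + u * v ^+ 2))),
       t)
  end.

(* The disjoint union of the charts. *)
Definition chart_point := {z : chart * (K * K * K) | chart_dom z.1 z.2}.

Definition glued (z w : chart_point) : bool :=
  (z == w) ||
  [&& chart_overlap (val z).1 (val z).2, chart_overlap (val w).1 (val w).2 &
      to_qpt (val z).1 (val z).2 == to_qpt (val w).1 (val w).2].

Lemma glued_refl : reflexive glued.
Proof. by move=> z; rewrite /glued eqxx. Qed.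

Lemma glued_sym : symmetric glued.
Proof.
move=> z w; rewrite /glued [w == z]eq_sym; congr (_ || _).
by rewrite andbCA [RHS]andbCA [to_qpt _ _ == _]eq_sym andbCA.
Qed.

Lemma glued_trans : transitive glued.
Proof.
move=> w z s /predU1P[-> //|/and3P[oz ow /eqP e1]].
move=> /predU1P[<-|/and3P[_ os /eqP e2]].
  by rewrite /glued oz ow e1 eqxx orbT.
by rewrite /glued oz os e1 e2 eqxx orbT.
Qed.

Canonical glued_equiv := EquivRel glued glued_refl glued_sym glued_trans.

(* The total space of the bundle over the t-line; gluing preserves t. *)
Definition ETak := {eq_quot glued_equiv}.

(* The right-hand side in chart i of the system with vector field X in the    *)
(* (q, p, t)-chart: to_qpt i maps the vector field (du/dt, dv/dt, 1) to X.    *)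
Definition chart_rhs (X : K * K * K -> K * K * K) (i : chart)
    (x : K * K * K) (w : K * K) : Prop :=
  [/\ chart_overlap i x, differentiable (to_qpt i) x &
      'd (to_qpt i) x (w.1, w.2, 1) = X (to_qpt i x)].

Definition regular_at (X : K * K * K -> K * K * K) (i : chart)
    (x : K * K * K) : Prop :=
  holomorphic_at (W := (K * K)%type) [set y | chart_overlap i y]
    (chart_rhs X i) x.

Definition quadratic_regularisable_at (X : K * K * K -> K * K * K)
    (i : chart) (x : K * K * K) : Prop :=
  i <> chart_qp /\
  exists R1 R2 : ratfun K,
    quadratic_regularisable [set y | chart_overlap i y] (chart_rhs X i) R1 R2 /\
    let: (u, v, t) := x in
    [/\ v = 0, ratfun_holomorphic_at R1 (t, u, 0)
      & ratfun_holomorphic_at R2 (t, u, 0)].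

Definition everywhere_regular_or_quadratic_regularisable
    (X : K * K * K -> K * K * K) : Prop :=
  forall P : ETak, exists z : chart_point, \pi_ETak z = P /\
    (regular_at X (val z).1 (val z).2 \/
     quadratic_regularisable_at X (val z).1 (val z).2).

End Takasaki.

(* Main.v *)
(* A point of chart i <> chart_qp with v <> 0 is glued to a point of the      *)
(* (q, p, t)-chart, where q <> 0 and the vector field is holomorphic.  At     *)
(* v = 0 one rewrites the system in (u, v) with h = v^2.  Charts 3 and 5 are  *)
(* the case b = 4 a1, -4 a1 of one computation, in which 8 beta = - b^2 makes *)
(* the pole of du/dt at h = 0 disappear; R2 is then 1/b at h = 0.  Charts 14  *)
(* and 20 are the case s = 1, -1 of another one, in which                     *)
(* c = - 4 s (alpha + s) does so and R2 is - s/8 at h = 0.                    *)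
Require Import Defs.
From mathcomp Require Import all_boot all_order all_algebra.
From mathcomp Require Import ring.
From mathcomp Require Import all_classical all_reals all_analysis.
Set Implicit Arguments.
Unset Strict Implicit.

Import GRing.Theory Num.Theory.
Import numFieldNormedType.Exports.
Local Open Scope ring_scope.

(** The map (q, p) -> (-q, -p) preserves the system and becomes v -> -v in the four other charts, so
    there u' is even and v' odd in v: both are governed by h = v^2, and it remains to see that no
    further pole at h = 0 survives. [quadratic_regularisable_at_frac] reduces this to polynomials
    with u' = N1/D and v' = N2/(D v), where D and N2 do not vanish at h = 0. [chart_rhs_is_diff]
    checks such formulas by pushing the field forward along the differential of [to_qpt]. *)

Section Diff.
Variable K : numFieldType.

(** * Differentials of explicit scalar expressions *)

Lemma is_diff_differentiable (U V : normedModType K) (f df : U -> V) z :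
  is_diff z f df -> differentiable f z.
Proof. by move=> d; exact: ex_diff. Qed.

Lemma is_diff_fst (U V : normedModType K) (z : U * V) :
  is_diff z (fst : U * V -> U) (fst : U * V -> U).
Proof.
have c : continuous (fst : U * V -> U) by move=> ?; exact: cvg_fst.
by apply: DiffDef; [exact: linear_differentiable|rewrite diff_lin].
Qed.

Lemma is_diff_snd (U V : normedModType K) (z : U * V) :
  is_diff z (snd : U * V -> V) (snd : U * V -> V).
Proof.
have c : continuous (snd : U * V -> V) by move=> ?; exact: cvg_snd.
by apply: DiffDef; [exact: linear_differentiable|rewrite diff_lin].
Qed.

Lemma is_diff_coord1 (z : K * K * K) :
  is_diff z (fun w : K * K * K => w.1.1) (fun h : K * K * K => h.1.1).
Proof. exact: is_diff_comp (is_diff_fst _) (is_diff_fst _). Qed.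

Lemma is_diff_coord2 (z : K * K * K) :
  is_diff z (fun w : K * K * K => w.1.2) (fun h : K * K * K => h.1.2).
Proof. exact: is_diff_comp (is_diff_fst _) (is_diff_snd _). Qed.

Variables (V : normedModType K) (x : V).
Implicit Types f g df dg : V -> K.

Lemma is_diff_const (c : K) : is_diff x (fun=> c) (fun=> 0).
Proof. exact: is_diff_cst. Qed.

Lemma is_diff_add f g df dg : is_diff x f df -> is_diff x g dg ->
  is_diff x (fun z => f z + g z) (fun h => df h + dg h).
Proof. exact: is_diffD. Qed.

Lemma is_diff_mul f g df dg : is_diff x f df -> is_diff x g dg ->
  is_diff x (fun z => f z * g z) (fun h => f x * dg h + g x * df h).
Proof. exact: is_diffM. Qed.

Lemma is_diff_exp f df n : is_diff x f df ->
  is_diff x (fun z => f z ^+ n.+1) (fun h => n.+1%:R * f x ^+ n * df h).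
Proof.
move=> d; have := is_diffX n d; congr (is_diff _ _ _).
by apply/funext => z; rewrite exprfctE.
Qed.

Lemma is_diff_inv f df : is_diff x f df -> f x != 0 ->
  is_diff x (fun z => (f z)^-1) (fun h => - f x ^- 2 * df h).
Proof.
move=> d fx0; have ? : differentiable f x by exact: ex_diff.
apply: DiffDef; first exact: differentiableV.
by rewrite diffV// diff_val.
Qed.

End Diff.

(** * Values and holomorphy of rational functions *)

Section Eval.
Variable K : numFieldType.
Implicit Types (N D P : {poly {poly {poly K}}}) (f : ratfun K).
Local Open Scope classical_set_scope.

Lemma eval3_neq0 P t x y : eval3 P t x y != 0 -> P != 0.
Proof. by apply: contraNneq => ->; rewrite /eval3 !horner0. Qed.

(** [ratfun_val] allows any representing fraction; cross-multiplying two of them and evaluating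
    shows that the value does not depend on the choice. *)
Lemma ratfun_val_frac N D t x y c : eval3 D t x y != 0 ->
  ratfun_val (tofrac N / tofrac D) (t, x, y) c ->
  c = eval3 N t x y / eval3 D t x y.
Proof.
move=> D0 [N' [D' [/eqP + D'0 ->]]].
rewrite eqr_div ?tofrac_eq0 ?(eval3_neq0 D0) ?(eval3_neq0 D'0)//.
rewrite -!tofracM tofrac_eq => /eqP/(congr1 (fun P => eval3 P t x y)).
rewrite /eval3 !hornerM -/(eval3 _ _ _ _) => e.
by apply/eqP; rewrite eqr_div// e.
Qed.

Lemma differentiable_eval3 P (z : K * K * K) :
  differentiable (fun w => eval3 P w.1.1 w.1.2 w.2) z.
Proof.
have d1 := is_diff_differentiable (is_diff_coord1 z).
have d2 := is_diff_differentiable (is_diff_coord2 z).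
have d3 : differentiable (fun w : K * K * K => w.2) z.
  exact: is_diff_differentiable (is_diff_snd z).
(* One induction per polynomial layer, from the innermost variable outwards; each layer provides the
   coefficients of the next. *)
have dp (p : {poly K}) : differentiable (fun w : K * K * K => p.[w.1.1]) z.
  elim/poly_ind: p => [|p c IH].
    by under eq_fun do rewrite horner0; exact: differentiable_cst.
  under eq_fun do rewrite hornerMXaddC.
  by apply: differentiableD; [exact: differentiableM|exact: differentiable_cst].
have dq (p : {poly {poly K}}) :
    differentiable (fun w : K * K * K => p.[w.1.2%:P].[w.1.1]) z.
  elim/poly_ind: p => [|p c IH].
    by under eq_fun do rewrite !horner0; exact: differentiable_cst.
  under eq_fun do rewrite hornerMXaddC hornerD hornerM hornerC.
  by apply: differentiableD => //; exact: differentiableM.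
rewrite /eval3; elim/poly_ind: P => [|p c IH].
  by under eq_fun do rewrite !horner0; exact: differentiable_cst.
under eq_fun do rewrite hornerMXaddC !hornerD !hornerM !hornerC.
by apply: differentiableD => //; exact: differentiableM.
Qed.

Lemma near_eval3_neq0 P t x y : eval3 P t x y != 0 ->
  \forall w \near (t, x, y), eval3 P w.1.1 w.1.2 w.2 != 0.
Proof.
move=> P0.
have /differentiable_continuous c := differentiable_eval3 P (t, x, y).
exact: (cvgr_neq0 (eval3 P t x y) c P0).
Qed.

Lemma ratfun_holomorphic_at_frac N D t x y : eval3 D t x y != 0 ->
  ratfun_holomorphic_at (tofrac N / tofrac D) (t, x, y).
Proof.
move=> D0; have nD := near_eval3_neq0 D0.
exists (fun w => eval3 N w.1.1 w.1.2 w.2 / eval3 D w.1.1 w.1.2 w.2); split.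
  apply: filterS nD => w D'0; apply: differentiableM.
    exact: differentiable_eval3.
  by apply: differentiableV => //; exact: differentiable_eval3.
apply: filterS nD => -[[t' x'] y'] /= D'0 _.
by exists N, D.
Qed.

Lemma quadratic_regularisable_at_frac a1 a2 X i (u t : K) N1 N2 D :
    i <> chart_qp ->
    (forall t x, eval3 D t x 0 != 0) -> (forall t x, eval3 N2 t x 0 != 0) ->
    (forall u v t, chart_overlap a1 i (u, v, t) -> eval3 D t u (v ^+ 2) != 0) ->
    (forall u v t, chart_overlap a1 i (u, v, t) ->
      chart_rhs a1 a2 X i (u, v, t)
        (eval3 N1 t u (v ^+ 2) / eval3 D t u (v ^+ 2),
         eval3 N2 t u (v ^+ 2) / eval3 D t u (v ^+ 2) / v)) ->
  quadratic_regularisable_at a1 a2 X i (u, 0, t).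
Proof.
move=> iqp D0 N20 Dh rhsE; split => //.
exists (tofrac N1 / tofrac D), (tofrac N2 / tofrac D); split; last first.
  by split => //; exact: ratfun_holomorphic_at_frac.
(* A nonzero value at the single point (0, 0, 0) already forces [D.[0]] to be a nonzero
   polynomial. *)
have r0 N : ratfun_regular0 (tofrac N / tofrac D).
  exists N, D; split => //; apply: contraNneq (D0 0 0) => e.
  by rewrite /eval3 e !horner0.
split => // [t' x c|u' v t' c1 c2 oi].
  by move=> /ratfun_val_frac -> //; rewrite mulf_neq0 ?invr_eq0.
have D'0 := Dh _ _ _ oi.
move=> /(ratfun_val_frac D'0)-> /(ratfun_val_frac D'0)->.
exact: rhsE.
Qed.

End Eval.

(* [x ^+ 2] unifies with a product, so [is_diff_exp] is tried first. *)
Ltac is_diff_tac := repeat first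
  [ apply: is_diff_pair | apply: is_diff_const | apply: is_diff_coord1
  | apply: is_diff_coord2 | apply: is_diff_snd | apply: is_diff_add
  | apply: is_diff_exp | apply: is_diff_mul | apply: is_diff_inv ].

(** * The system in each chart *)

Section Charts.
Variable K : numFieldType.

(* Type class inference finds the zero function as derivative of a constant; *)
(* unless it is unfolded, [field] takes its values for atoms.                *)
Lemma fct0E (T : Type) (x : T) : (0 : T -> K) x = 0.
Proof. by []. Qed.

Lemma is_diff_zero_chart (b u v t : K) : v != 0 ->
  is_diff (u, v, t)
    (fun z : K * K * K =>
      (z.1.2 * (b + z.1.1 * z.1.2 ^+ 2), z.1.2^-1, z.2))
    (fun h => (h.1.2 * (b + 3 * u * v ^+ 2) + h.1.1 * v ^+ 3,
               - h.1.2 / v ^+ 2, h.2)).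
Proof.
move=> v0; apply: is_diff_eq; first by is_diff_tac.
by apply/funext => -[[h k] l]; rewrite fct0E /=; congr (_, _, _); field.
Qed.

Lemma is_diff_pole_chart (e s c u v t : K) : v != 0 ->
  is_diff (u, v, t)
    (fun z : K * K * K =>
      (z.1.2^-1,
       1 / z.1.2 ^+ 3 * (e + z.1.2 ^+ 2 * (s * z.2 + z.1.2 ^+ 2 *
         (c + z.1.1 * z.1.2 ^+ 2))),
       z.2))
    (fun h => (- h.1.2 / v ^+ 2,
       h.1.1 * v ^+ 3 + s * h.2 / v
         + (- 3 * e / v ^+ 4 - s * t / v ^+ 2 + c + 3 * u * v ^+ 2) * h.1.2,
       h.2)).
Proof.
move=> v0; apply: is_diff_eq; first by is_diff_tac; rewrite //= expf_neq0.
by apply/funext => -[[h k] l]; rewrite fct0E /=; congr (_, _, _); field.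
Qed.

Lemma chart_rhs_is_diff a1 a2 X i (x : K * K * K) D w :
  chart_overlap a1 i x -> is_diff x (to_qpt a1 a2 i) D ->
  D (w.1, w.2, 1) = X (to_qpt a1 a2 i x) -> chart_rhs a1 a2 X i x w.
Proof. by move=> oi d e; split; rewrite ?diff_val //; exact: ex_diff. Qed.

Let eval3E := (hornerD, hornerN, hornerM, horner_exp, hornerC, hornerX).

Notation T3 := ('X%:P%:P : {poly {poly {poly K}}}).
Notation X3 := ('X%:P : {poly {poly {poly K}}}).
Notation Y3 := ('X : {poly {poly {poly K}}}).
Notation C3 c := (c%:P%:P%:P : {poly {poly {poly K}}}).

(* With h = v^2 and S = b + u h, the system reads h^2 S^3 R1 = S^3 -          *)
(* (b + 3 u h) S^3 R2 and S^3 R2 = b^2 - h^2 S^3 G; the coefficients of h^0   *)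
(* and h^1 in the first equation cancel.                                      *)
Lemma quadratic_regularisable_zero_chart a1 a2 alpha beta b i (u t : K) :
    i <> chart_qp -> b != 0 -> 8 * beta = - b ^+ 2 ->
    (forall u v t, chart_overlap a1 i (u, v, t) ->
      b + u * v ^+ 2 != 0 /\ v != 0) ->
    to_qpt a1 a2 i = (fun z : K * K * K =>
      (z.1.2 * (b + z.1.1 * z.1.2 ^+ 2), z.1.2^-1, z.2)) ->
  quadratic_regularisable_at a1 a2 (takasaki alpha beta) i (u, 0, t).
Proof.
move=> iqp b0 betaE oE qptE.
pose S := C3 b + X3 * Y3.
(* With q = v S, this is the polynomial part of p' divided by v: p' = 8 beta / (v S)^3 + v G. *)
pose G := (T3 ^+ 2 - C3 alpha) * S + C3 (1 / 2) * T3 * Y3 * S ^+ 3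
  + C3 (3 / 64) * Y3 ^+ 2 * S ^+ 5.
pose N1 := C3 (3 * b) * X3 ^+ 2 + X3 ^+ 3 * Y3
  + (C3 b + C3 3 * X3 * Y3) * S ^+ 3 * G.
pose N2 := C3 (b ^+ 2) - Y3 ^+ 2 * S ^+ 3 * G.
have SE t' x y : eval3 (S ^+ 3) t' x y = (b + x * y) ^+ 3.
  by rewrite /eval3 /S !eval3E.
have N2E t' x y : eval3 N2 t' x y = b ^+ 2 - y ^+ 2 * (b + x * y) ^+ 3 *
    ((t' ^+ 2 - alpha) * (b + x * y) + t' / 2 * y * (b + x * y) ^+ 3
      + 3 / 64 * y ^+ 2 * (b + x * y) ^+ 5).
  by rewrite /eval3 /N2 /G /S !eval3E; field.
have N1E t' x y : eval3 N1 t' x y = 3 * b * x ^+ 2 + x ^+ 3 * y +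
    (b + 3 * x * y) * (b + x * y) ^+ 3 *
    ((t' ^+ 2 - alpha) * (b + x * y) + t' / 2 * y * (b + x * y) ^+ 3
      + 3 / 64 * y ^+ 2 * (b + x * y) ^+ 5).
  by rewrite /eval3 /N1 /G /S !eval3E; field.
apply: (@quadratic_regularisable_at_frac _ _ _ _ _ _ _ N1 N2 (S ^+ 3)) => //.
- by move=> t' x; rewrite SE mulr0 addr0 expf_neq0.
- by move=> t' x; rewrite N2E expr0n/= !mul0r subr0 expf_neq0.
- by move=> u' v t' /oE[s0 _]; rewrite SE expf_neq0.
move=> u' v t' oi; have [s0 v0] := oE _ _ _ oi.
apply: chart_rhs_is_diff => //.
  by rewrite qptE; exact: is_diff_zero_chart.
rewrite qptE /takasaki /= betaE SE N1E N2E.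
by congr (_, _, _); field; rewrite ?s0 ?v0.
Qed.

(* With h = v^2 and W = s/8 + s t h + c h^2 + u h^3, the system reads         *)
(* R2 = - W and h^4 R1 = 8 beta h^4 + (t^2 - alpha) h^2 + t h / 2 + 3/64      *)
(* - 3 W^2 - s h^2 + 2 h W (s t + 2 c h + 3 u h^2).  The coefficients of h^0, *)
(* h^1 and h^3 cancel because s^2 = 1, that of h^2 by the choice of c.        *)
Lemma quadratic_regularisable_pole_chart a1 a2 alpha beta s c i (u t : K) :
    i <> chart_qp -> s ^+ 2 = 1 -> c = - 4 * s * (alpha + s) ->
    (forall u v t, chart_overlap a1 i (u, v, t) -> v != 0) ->
    to_qpt a1 a2 i = (fun z : K * K * K =>
      (z.1.2^-1,
       1 / z.1.2 ^+ 3 * (s / 8 + z.1.2 ^+ 2 * (s * z.2 + z.1.2 ^+ 2 *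
         (c + z.1.1 * z.1.2 ^+ 2))),
       z.2)) ->
  quadratic_regularisable_at a1 a2 (takasaki alpha beta) i (u, 0, t).
Proof.
move=> iqp s2 cE oE qptE.
pose N1 := C3 (8 * beta + c ^+ 2) + C3 (2 * s) * T3 * X3
  + C3 (4 * c) * X3 * Y3 + C3 3 * X3 ^+ 2 * Y3 ^+ 2.
pose N2 := - (C3 (s / 8) + C3 s * T3 * Y3 + C3 c * Y3 ^+ 2 + X3 * Y3 ^+ 3).
have N1E t' x y : eval3 N1 t' x y = 8 * beta + c ^+ 2 + 2 * s * t' * x
    + 4 * c * x * y + 3 * x ^+ 2 * y ^+ 2.
  by rewrite /eval3 /N1 !eval3E.
have N2E t' x y :
    eval3 N2 t' x y = - (s / 8 + s * t' * y + c * y ^+ 2 + x * y ^+ 3).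
  by rewrite /eval3 /N2 !eval3E.
have E1 t' x y : eval3 1 t' x y = 1 :> K by rewrite /eval3 !hornerE.
have s0 : s != 0.
  by apply: contra_eq_neq s2 => ->; rewrite expr0n eq_sym oner_eq0.
(* Here u' and v v' are polynomial in t, u and h, so the denominator is 1. *)
apply: (@quadratic_regularisable_at_frac _ _ _ _ _ _ _ N1 N2 1) => //.
- by move=> t' x; rewrite E1 oner_eq0.
- move=> t' x; rewrite N2E !expr0n /= !mulr0 !addr0 oppr_eq0.
  by rewrite mulf_neq0// invr_eq0 pnatr_eq0.
- by move=> u' v t' _; rewrite E1 oner_eq0.
move=> u' v t' oi; have v0 := oE _ _ _ oi.
apply: chart_rhs_is_diff => //.
  by rewrite qptE; exact: is_diff_pole_chart.
rewrite qptE /takasaki /= E1 N1E N2E.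
(* The cancellations use s^2 = 1, which [field] sees once s is a numeral. *)
have /orP[/eqP ss|/eqP ss] : (s == 1) || (s == -1) by rewrite -sqrf_eq1 s2.
  by rewrite cE ss; congr (_, _, _); field.
by rewrite cE ss; congr (_, _, _); field.
Qed.

Lemma to_qpt_qp (a1 a2 : K) : to_qpt a1 a2 chart_qp = id.
Proof. by apply/funext => -[[]]. Qed.

Lemma regular_at_chart_qp (a1 a2 alpha beta q p t : K) : q != 0 ->
  regular_at a1 a2 (takasaki alpha beta) chart_qp (q, p, t).
Proof.
move=> q0.
exists (fun z => ((takasaki alpha beta z).1.1, (takasaki alpha beta z).1.2)).
have nq : (\forall z \near (q, p, t), z.1.1 != 0)%classic.
  have /differentiable_continuous c :=
    is_diff_differentiable (is_diff_coord1 (q, p, t)).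
  exact: (cvgr_neq0 q c q0).
split.
  apply: filterS nq => -[[q' p'] t'] /= q'0.
  apply: is_diff_differentiable.
  have -> : (fun z : K * K * K =>
      ((takasaki alpha beta z).1.1, (takasaki alpha beta z).1.2)) =
    (fun z => (z.1.2, 8 * beta / z.1.1 ^+ 3 + (z.2 ^+ 2 - alpha) * z.1.1
      + z.2 / 2 * z.1.1 ^+ 3 + 3 / 64 * z.1.1 ^+ 5)) by apply/funext => -[[]].
  by is_diff_tac; rewrite expf_neq0.
apply: filterS nq => -[[q' p'] t'] /= q'0 oi.
apply: (@chart_rhs_is_diff _ _ _ _ _ id) => //.
by rewrite to_qpt_qp; exact: is_diff_id.
Qed.

End Charts.

Theorem proposition3 (R : realType) (a1 a2 alpha beta : R[i])
    (ha1 : a1 != 0)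
    (halpha : alpha = 1 - a1 - 2 * a2) (hbeta : beta = - 2 * a1 ^+ 2) :
  everywhere_regular_or_quadratic_regularisable a1 a2 (takasaki alpha beta).
Proof.
move=> P; have [z zP] : exists z, \pi_(ETak a1 a2)%qT z = P.
  by exists (repr P); exact: reprK.
have [oz|noz] := boolP (chart_overlap a1 (val z).1 (val z).2).
  (* The image of the point in the (q, p, t)-chart represents the same class. *)
  pose y := to_qpt a1 a2 (val z).1 (val z).2.
  have y0 : chart_dom a1 chart_qp y.
    rewrite /y; case: (val z) oz => i [[u v] t] /= /andP[]; case: i => //= d v0.
    - by rewrite mulf_neq0.
    - by rewrite mulf_neq0.
    - by rewrite invr_eq0.
    - by rewrite invr_eq0.
  exists (exist _ (chart_qp, y) y0); split.
    rewrite -zP; apply/eqmodP/orP; right; apply/and3P; split => //.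
      by move: y0; rewrite /chart_overlap /= => ->.
    by rewrite /= to_qpt_qp.
  by left; case: y y0 => [[q p] t] /= q0; exact: regular_at_chart_qp.
(* Lying in its chart but outside the overlap, the point has v = 0 in one of the four other
   charts. *)
exists z; split => //; right.
case: z {zP} noz => -[i [[u v] t]] zd.
rewrite /chart_overlap [chart_dom _ _ _]zd /=.
case: i {zd} => //= /negPn/eqP->.
- apply: (@quadratic_regularisable_zero_chart _ _ _ _ _ (4 * a1)) => //.
  + by rewrite mulf_neq0// pnatr_eq0.
  + by rewrite hbeta; ring.
  + by move=> u' v' t' /andP[].
  + by apply/funext => -[[]].
- apply: (@quadratic_regularisable_zero_chart _ _ _ _ _ (- 4 * a1)) => //.
  + by rewrite mulf_neq0// oppr_eq0 pnatr_eq0.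
  + by rewrite hbeta; ring.
  + by move=> u' v' t' /andP[].
  + by apply/funext => -[[]].
- apply: (@quadratic_regularisable_pole_chart _ _ _ _ _ 1
    (4 * (a1 + 2 * a2 - 2))) => //.
  + exact: expr1n.
  + by rewrite halpha; ring.
  + by apply/funext => -[[u' v'] t'] /=; rewrite !mul1r.
- apply: (@quadratic_regularisable_pole_chart _ _ _ _ _ (- 1)
    (- 4 * (a1 + 2 * a2))) => //.
  + by rewrite sqrrN expr1n.
  + by rewrite halpha; ring.
  + by apply/funext => -[[u' v'] t'] /=; rewrite !mulN1r !mul1r.
Qed.
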